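(* Let $\mathbb D\subset\mathbb C$ be contractible and let $f:\mathbb D\to SO^+(1,n+3)/SO^+(1,3)\times SO(n)$ be a harmonic map with symmetry $(\gamma,R)$. Let $F=F_-F_+$ be the Birkhoff decomposition (away from a discrete subset of $\mathbb D$) of the extended frame $F$ of $f$, and let $\chi=\chi(\lambda)$ be a monodromy matrix of $\gamma$. Then $$\gamma^*F_-=\chi\,F_-\,V_+$$ for some $V_+$. Moreover, $V_+\in\Lambda^+SO^+(1,n+3,\mathbb C)_\sigma$ if $\det\chi=1$, and $V_+\tilde P\in\Lambda^+SO^+(1,n+3,\mathbb C)_\sigma$ if $\det\chi=-1$. For the normalized potential $\eta$ of $f$ one has $$\gamma^*\eta=V_+^{-1}\,\eta\,V_++V_+^{-1}\,dV_+ .$$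
   Context: Fix $n\ge1$. $O^+(1,n+3)$ is the group of linear isometries of $\mathbb{R}^{n+4}$ with form $-x_0^2+x_1^2+\dots+x_{n+3}^2$ that preserve the forward light cone; $G=SO^+(1,n+3)$ is its identity component; $K=SO^+(1,3)\times SO(n)$ (block diagonal); $\sigma=\mathrm{Ad}\,\mathrm{diag}(-I_4,I_n)$; $G^{\mathbb C}=SO^+(1,n+3,\mathbb C)=SO(1,n+3,\mathbb C)$; $\mathfrak g=\mathfrak k\oplus\mathfrak p$ is the eigenspace decomposition of $\sigma$; $\tilde P=\mathrm{diag}(1,1,1,1,-1,1,\dots,1)$. $R\in O^+(1,n+3)$ acts on $G/K$ by $gK\mapsto RgK$ if $\det R=1$ and $gK\mapsto Rg\tilde PK$ if $\det R=-1$. A symmetry $(\gamma,R)$ of $f$ consists of a holomorphic automorphism $\gamma$ of $\mathbb D$ and $R\in O^+(1,n+3)$ with $f(\gamma(p))=R f(p)$ for all $p\in\mathbb D$. Extended frame: given a lift $F:\mathbb D\to G$ of $f$ with $\alpha=F^{-1}dF=\alpha_{\mathfrak k}+\alpha'_{\mathfrak p}+\alpha''_{\mathfrak p}$ ($(1,0)$- and $(0,1)$-parts of the $\mathfrak p$-part) and $\alpha_\lambda=\lambda^{-1}\alpha'_{\mathfrak p}+\alpha_{\mathfrak k}+\lambda\alpha''_{\mathfrak p}$, $F(z,\bar z,\lambda)$ is the solution of $dF=F\alpha_\lambda$, $F(0,0,\lambda)=I$ (where $0\in\mathbb D$ and $f(0)=eK$). A monodromy matrix of $\gamma$ is a $\chi(\lambda)$,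 $\lambda\in S^1$, satisfying $\gamma^*F(z,\bar z,\lambda)=\chi(\lambda)F(z,\bar z,\lambda)k(z,\bar z)$ with $k:\mathbb D\to SO^+(1,3)\times O(n)$ independent of $\lambda$, with $\chi\in(\Lambda G_\sigma)^0$ if $\det R=1$ and $\chi\tilde P\in(\Lambda G_\sigma)^0$ if $\det R=-1$ (such a $\chi$ exists; $(\cdot)^0$ denotes identity component). Loop groups: $\Lambda G^{\mathbb C}_\sigma=\{g:S^1\to G^{\mathbb C}\mid\sigma(g(\lambda))=g(-\lambda)\}$; $\Lambda G_\sigma$ the loops with values in $G$; $\Lambda^+G^{\mathbb C}_\sigma$ (also written $\Lambda^+SO^+(1,n+3,\mathbb C)_\sigma$) the loops extending holomorphically to $|\lambda|<1$; $\Lambda^-_*G^{\mathbb C}_\sigma$ those extending holomorphically to $|\lambda|>1$ with value $I$ at $\infty$. Birkhoff decomposition: on the complement of a discrete subset, $F=F_-F_+$ with $F_-\in\Lambda^-_*G^{\mathbb C}_\sigma$, $F_+\in\Lambda^+G^{\mathbb C}_\sigma$, where $F_-$ is meromorphic in $z\in\mathbb D$; $\eta=F_-^{-1}dF_-$ is the normalized potential of $f$. *)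

(* Defs.v *)
From HB Require Import structures.
From mathcomp Require Import all_boot all_order all_algebra.
From mathcomp Require Import complex.
From mathcomp Require Import all_classical all_reals all_analysis.

Set Implicit Arguments.
Unset Strict Implicit.
Unset Printing Implicit Defensive.

Import Order.TTheory GRing.Theory Num.Theory.
Import numFieldNormedType.Exports.

Local Open Scope classical_set_scope.
Local Open Scope ring_scope.

(* R[i] packed as a numClosedFieldType, so that the topology and the normed
   module structure of a numFieldType over itself are inferred on it. *)
Definition cplx (R : realType) : numClosedFieldType := R[i].

Section Calculus.
Variables (R : realType).
Local Notation C := (cplx R).

Definition ofR (t : R) : C := real_complex R t.

Definition circle : set C := [set l | `|l| = 1].

Definition cmx m n (A : 'M[R]_(m, n)) : 'M[C]_(m, n) := map_mx ofR A.

Section Differential.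
Variable W : normedModType C.
Implicit Types (F : C -> W) (U : set C).

(* Difference quotients with real increments: the derivatives below are those
   of functions on the real plane underlying C. *)
Definition dquot F (z v : C) : R -> W :=
  fun t => (ofR t)^-1 *: (F (z + ofR t * v) - F z).

(* A W-valued 1-form is a function of a point and of a tangent vector. *)
Definition dR F (z v : C) : W := lim (dquot F z v @ 0^').

Definition iter_d (vs : seq C) F : C -> W :=
  foldr (fun v G z => dR G z v) F vs.

Definition smooth_on U F := forall vs z, U z ->
  {for z, continuous (iter_d vs F)} /\
  forall v, cvg (dquot (iter_d vs F) z v @ 0^').

(* derivable with scalars in C: complex differentiability *)
Definition holomorphic_on U F := forall z, U z -> derivable F z 1.

Definition meromorphic_at F (s : C) := exists (m : nat) (h : C -> W),
  (\forall z \near s, derivable h z 1) /\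
  (\forall z \near s^', (z - s) ^+ m *: F z = h z).

End Differential.

Definition pullback (W : Type) (g : C -> C) (w : C -> C -> W) : C -> C -> W :=
  fun z v => w (g z) (dR (g : C -> C) z v).

(* Discrete in the sense of complex analysis: no accumulation point in D. *)
Definition discrete_in (D S : set C) :=
  S `<=` D /\ D `&` limit_point S = set0.

Definition contractible (D : set C) := exists (z0 : C) (H : R * C -> C),
  [/\ D z0,
      {within `[0, 1]%classic `*` D, continuous H},
      forall t z, t \in `[0, 1] -> D z -> D (H (t, z)),
      forall z, D z -> H (0, z) = z &
      forall z, D z -> H (1, z) = z0].

Definition holomorphic_aut (D : set C) (g : C -> C) := exists h : C -> C,
  [/\ holomorphic_on D g, holomorphic_on D h,
      (forall z, D z -> D (g z) /\ h (g z) = z) &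
      (forall z, D z -> D (h z) /\ g (h z) = z)].

End Calculus.

Arguments cmx {R m n} A.

(* The form - x_0^2 + x_1^2 + ... + x_m^2. *)
Definition minkowski (F : comNzRingType) (m : nat) : 'M[F]_m.+1 :=
  diag_mx (\row_j (if j == ord0 then -1 else 1)).

Definition lorentz_isometry (F : comNzRingType) (m : nat) (A : 'M[F]_m.+1) :=
  A^T *m minkowski F m *m A = minkowski F m.

Section RealGroups.
Variables (R : realType).

Definition light_cone (m : nat) : set 'cV[R]_m.+1 :=
  [set x | x^T *m minkowski R m *m x = 0 /\ 0 < x ord0 ord0].

Definition Oplus (m : nat) : set 'M[R]_m.+1 :=
  [set A | lorentz_isometry A /\ [set A *m x | x in @light_cone m] = @light_cone m].

Definition SOplus (m : nat) : set 'M[R]_m.+1 :=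
  connected_component (@Oplus m) 1%:M.

Definition Orth (n : nat) : set 'M[R]_n := [set B | B^T *m B = 1%:M].

Definition SOrth (n : nat) : set 'M[R]_n := [set B | Orth B /\ \det B = 1].

End RealGroups.

Arguments light_cone {R} m.
Arguments Oplus {R} m.
Arguments SOplus {R} m.
Arguments Orth {R} n.
Arguments SOrth {R} n.

Section SymmetricSpace.
Variables (R : realType) (n : nat).
Local Notation C := (cplx R).

Definition G : set 'M[R]_(4 + n) := SOplus (3 + n).

Definition K : set 'M[R]_(4 + n) :=
  [set block_mx A 0 0 B | A in SOplus 3 & B in SOrth n].

Definition KO : set 'M[R]_(4 + n) :=
  [set block_mx A 0 0 B | A in SOplus 3 & B in Orth n].

Definition Ptilde (F : comNzRingType) : 'M[F]_(4 + n) :=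
  diag_mx (\row_j (if val j == 4%N then -1 else 1)).

Definition sgnmx (F : comNzRingType) : 'M[F]_(4 + n) :=
  block_mx (- 1%:M) 0 0 1%:M.

(* Ad sgnmx: sgnmx is its own inverse *)
Definition sigma (F : comNzRingType) (X : 'M[F]_(4 + n)) : 'M[F]_(4 + n) :=
  sgnmx F *m X *m sgnmx F.

(* Projections on the eigenspaces of sigma for the eigenvalues 1 and -1. *)
Definition kpart (X : 'M[C]_(4 + n)) : 'M[C]_(4 + n) := 2^-1 *: (X + sigma X).
Definition ppart (X : 'M[C]_(4 + n)) : 'M[C]_(4 + n) := 2^-1 *: (X - sigma X).

(* Points of G/K are left cosets. *)
Definition cosetK (g : 'M[R]_(4 + n)) : set 'M[R]_(4 + n) :=
  [set g *m k | k in K].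

Definition actGK (A : 'M[R]_(4 + n)) (X : set 'M[R]_(4 + n)) :
    set 'M[R]_(4 + n) :=
  \bigcup_(g in X) cosetK (if \det A == 1 then A *m g else A *m g *m Ptilde R).

Definition form := C -> C -> 'M[C]_(4 + n).

Definition maurer_cartan (F : C -> 'M[C]_(4 + n)) : form :=
  fun z v => invmx (F z) *m dR F z v.

(* (1,0)- and (0,1)-parts *)
Definition form10 (w : form) : form :=
  fun z v => 2^-1 *: (w z v - 'i *: w z ('i * v)).
Definition form01 (w : form) : form :=
  fun z v => 2^-1 *: (w z v + 'i *: w z ('i * v)).

Definition is_lift (U : set C) (f : C -> set 'M[R]_(4 + n))
    (F : C -> 'M[R]_(4 + n)) :=
  smooth_on U (cmx \o F) /\ forall z, U z -> G (F z) /\ f z = cosetK (F z).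

(* The bundle T(G/K) is G x_K p, and its Levi-Civita connection, for the
   metric induced by the trace form, is the canonical one. In the frame F, the
   differential of f is the p-part of alpha = F^-1 dF and the covariant
   derivative of a section xi : U -> p along f is d xi + [alpha_k, xi]. The
   tension field is the trace of the covariant derivative of df. *)
Definition tension (F : C -> 'M[R]_(4 + n)) (z : C) : 'M[C]_(4 + n) :=
  let alpha := maurer_cartan (cmx \o F) in
  \sum_(v <- [:: 1; 'i] : seq C)
    (dR (fun w => ppart (alpha w v)) z v
     + (kpart (alpha z v) *m ppart (alpha z v)
        - ppart (alpha z v) *m kpart (alpha z v))).

(* G -> G/K has smooth local sections, so f is smooth exactly when it has
   smooth lifts locally; the tension field does not depend on the lift. *)
Definition harmonic_map (D : set C) (f : C -> set 'M[R]_(4 + n)) :=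
  (forall z, D z -> exists (U : set C) F,
     [/\ open U, U z, U `<=` D & is_lift U f F]) /\
  (forall (U : set C) F, open U -> U `<=` D -> is_lift U f F ->
     forall z, U z -> tension F z = 0).

Definition is_symmetry (D : set C) (f : C -> set 'M[R]_(4 + n))
    (g : C -> C) (A : 'M[R]_(4 + n)) :=
  [/\ holomorphic_aut D g, Oplus (3 + n) A &
      forall p, D p -> f (g p) = actGK A (f p)].

Definition alpha_lambda (F : C -> 'M[R]_(4 + n)) (l : C) : form :=
  let alpha := maurer_cartan (cmx \o F) in
  let alphap : form := fun z v => ppart (alpha z v) in
  fun z v =>
    l^-1 *: form10 alphap z v + kpart (alpha z v) + l *: form01 alphap z v.

Definition extended_frame (D : set C) (F0 : C -> 'M[R]_(4 + n))
    (F : C -> C -> 'M[C]_(4 + n)) :=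
  forall l, circle l ->
    [/\ smooth_on D (F^~ l), F 0 l = 1%:M &
        forall z v, D z -> dR (F^~ l) z v = F z l *m alpha_lambda F0 l z v].

(* Loops are continuous; they are functions on C of which only the values on
   circle matter. *)
Definition SOC : set 'M[C]_(4 + n) :=
  [set A | @lorentz_isometry C (3 + n) A /\ \det A = 1].

Definition LoopC : set (C -> 'M[C]_(4 + n)) :=
  [set g | {within @circle R, continuous g} /\
           forall l, circle l -> SOC (g l) /\ sigma (g l) = g (- l)].

Definition LoopR : set (C -> 'M[C]_(4 + n)) :=
  [set g | LoopC g /\ forall l, circle l -> (cmx @` G) (g l)].

(* Identity component for the topology of uniform convergence on circle *)
Definition LoopR0 : set (C -> 'M[C]_(4 + n)) :=
  connected_component (LoopR : set {uniform` @circle R -> 'M[C]_(4 + n)})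
    (fun=> 1%:M).

Definition LoopPlus : set (C -> 'M[C]_(4 + n)) :=
  [set g | LoopC g /\ exists h : C -> 'M[C]_(4 + n),
     [/\ {within [set l : C | `|l| <= 1], continuous h},
         holomorphic_on [set l : C | `|l| < 1] h,
         (forall l : C, `|l| <= 1 -> SOC (h l)) &
         forall l : C, circle l -> h l = g l]].

Definition LoopMinusStar : set (C -> 'M[C]_(4 + n)) :=
  [set g | LoopC g /\ exists h : C -> 'M[C]_(4 + n),
     [/\ {within [set l : C | 1 <= `|l|], continuous h},
         holomorphic_on [set l : C | 1 < `|l|] h,
         (forall l : C, 1 <= `|l| -> SOC (h l)),
         h l^-1 @[l --> (0 : C)^'] --> (1%:M : 'M[C]_(4 + n)) &
         forall l : C, circle l -> h l = g l]].

Definition birkhoff (D : set C) (F : C -> C -> 'M[C]_(4 + n)) (S : set C)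
    (Fm Fp : C -> C -> 'M[C]_(4 + n)) :=
  [/\ discrete_in D S,
      (forall z, (D `\` S) z -> LoopMinusStar (Fm z) /\ LoopPlus (Fp z)),
      (forall z l, (D `\` S) z -> circle l -> F z l = Fm z l *m Fp z l) &
      (forall l, circle l -> holomorphic_on (D `\` S) (Fm^~ l) /\
         forall s, S s -> meromorphic_at (Fm^~ l) s)].

Definition monodromy (D : set C) (F : C -> C -> 'M[C]_(4 + n)) (g : C -> C)
    (A : 'M[R]_(4 + n)) (chi : C -> 'M[C]_(4 + n)) :=
  [/\ (exists k : C -> 'M[R]_(4 + n),
         (forall z, D z -> KO (k z)) /\
         forall z l, D z -> circle l -> F (g z) l = chi l *m F z l *m cmx (k z)),
      (\det A = 1 -> LoopR0 chi) &
      (\det A = -1 -> LoopR0 (fun l => chi l *m Ptilde C))].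

Definition normalized_potential (Fm : C -> C -> 'M[C]_(4 + n)) (l : C) : form :=
  maurer_cartan (Fm^~ l).

End SymmetricSpace.

(* Main.v *)
Require Import Defs.
From HB Require Import structures.
From mathcomp Require Import all_boot all_order all_algebra.
From mathcomp Require Import complex.
From mathcomp Require Import all_classical all_reals all_analysis.

Set Implicit Arguments.
Unset Strict Implicit.
Unset Printing Implicit Defensive.

Import Order.TTheory GRing.Theory Num.Theory.
Import numFieldNormedType.Exports.

Local Open Scope classical_set_scope.
Local Open Scope ring_scope.

(** Evaluate F = F_- F_+ at z and at gamma(z) and compare through the monodromy
    relation:
      F_-(gamma z) F_+(gamma z) = chi F_-(z) F_+(z) k(z).
    Hence F_-(gamma z) = chi F_-(z) V with V given by two formulas,
      V = F_-(z)^-1 chi^-1 F_-(gamma z) = F_+(z) k(z) F_+(gamma z)^-1,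
    and the two halves of the theorem each read off one of them
    (monodromy_gauge).

    The second formula contains only plus loops and the constant loop k(z).
    Determinants force det k(z) = det chi, so k(z) is a determinant-one matrix
    when det chi = 1, while k(z) and the final factor Ptilde have determinants
    with product one when det chi = -1. In both cases V Q, with Q = 1 or
    Q = Ptilde, is a product f P g Q of plus loops f, g and of constants P, Q
    fixed by sigma with det P det Q = 1, and such products are plus loops
    (LoopPlus_sandwich). Inverses cause no trouble, since the inverse of a
    Lorentz matrix A is J A^T J, which is linear in A and hence inherits
    continuity and holomorphy in lambda.

    The first formula shows that V is holomorphic in z. As chi does not depend
    on z, differentiating F_- o gamma = chi F_- V gives the gauge
    transformation rule for the Maurer-Cartan form (maurer_cartan_gauge).
    The pulled back potential is the Maurer-Cartan form of F_- o gamma by the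
    chain rule (pullback_maurer_cartan). The exterior derivative is
    built from difference quotients along real lines; on holomorphic functions
    it is multiplication of the complex derivative by the tangent vector (dRE),
    so everything reduces to calculus in one complex variable. *)

(** * Limits and derivatives of matrix-valued functions *)

Section MatrixLimits.
Context {K : numFieldType} {T : Type} {F : set_system T} {FF : Filter F}.

Lemma cvg_mxP m n (f : T -> 'M[K]_(m, n)) (A : 'M[K]_(m, n)) :
  f @ F --> A <-> forall i j, (fun x => f x i j) @ F --> A i j.
Proof.
split=> [fA i j|fA P [Q AQ sQP]].
  exact: (cvg_comp _ _ fA (@coord_continuous _ _ _ i j A)).
have : \forall x \near F, forall ij : 'I_m * 'I_n, Q ij.1 ij.2 (f x ij.1 ij.2).
  by apply: filter_forall => ij; exact: fA (AQ ij.1 ij.2).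
by apply: filterS => x Qx; apply: sQP => i j; exact: (Qx (i, j)).
Qed.

Lemma cvg_mulmx m n p (f : T -> 'M[K]_(m, n)) (g : T -> 'M[K]_(n, p))
    (A : 'M[K]_(m, n)) (B : 'M[K]_(n, p)) :
  f @ F --> A -> g @ F --> B -> (fun x => f x *m g x) @ F --> A *m B.
Proof.
move=> /cvg_mxP fA /cvg_mxP gB; apply/cvg_mxP => i j.
rewrite mxE; under eq_fun do rewrite mxE.
apply: cvg_big => [|k _]; first exact: add_continuous.
by apply: cvgM; [exact: fA | exact: gB].
Qed.

Lemma cvg_trmx m n (f : T -> 'M[K]_(m, n)) (A : 'M[K]_(m, n)) :
  f @ F --> A -> (fun x => (f x)^T) @ F --> A^T.
Proof.
move=> /cvg_mxP fA; apply/cvg_mxP => i j.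
by rewrite mxE; under eq_fun do rewrite mxE; exact: fA.
Qed.

End MatrixLimits.

Section MatrixDerivatives.
Variable K : numFieldType.

Lemma derivable1_continuous (W : normedModType K) (f : K -> W) z :
  derivable f z 1 -> {for z, continuous f}.
Proof. by move=> /derivable1_diffP /differentiable_continuous. Qed.

(** In the difference quotient of f g the increment of f multiplies the value
    of g at the moving point, so the continuity of g enters. *)
Lemma is_derive_mulmx m n p (f : K -> 'M[K]_(m, n)) (g : K -> 'M[K]_(n, p)) z :
  derivable f z 1 -> derivable g z 1 ->
  is_derive z 1 (fun w => f w *m g w)
    ('D_1 f z *m g z + f z *m 'D_1 g z).
Proof.
move=> df dg.
suff lim_fg : h^-1 *: (((fun w => f w *m g w) \o shift z) (h *: 1)
    - f z *m g z) @[h --> 0^'] --> 'D_1 f z *m g z + f z *m 'D_1 g z.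
  by split; [apply/cvg_ex; eexists; exact: lim_fg | exact: cvg_lim lim_fg].
rewrite (_ : (fun h => _) =
    (fun h => (h^-1 *: ((f \o shift z) (h *: 1) - f z)) *m g (h *: 1 + z))
    + (fun h => f z *m (h^-1 *: ((g \o shift z) (h *: 1) - g z)))); last first.
  apply/funext => h /=.
  rewrite [RHS]/GRing.add/= -scalemxAl -scalemxAr -scalerDr; congr (_ *: _).
  by rewrite mulmxBl mulmxBr addrA subrK.
apply: cvgD; last by apply: cvg_mulmx; [exact: cvg_cst | exact: dg].
apply: cvg_mulmx; first exact: df.
apply: cvg_trans ((continuous_withinNshiftx g z).2 (derivable1_continuous dg)).
by apply: near_eq_cvg; near=> h; rewrite /= [h *: 1]mulr1.
Unshelve. all: by end_near. Qed.

Lemma derivable_trmx m n (f : K -> 'M[K]_(m, n)) z :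
  derivable f z 1 -> derivable (fun w => (f w)^T) z 1.
Proof.
move=> df; apply/cvg_ex; exists ('D_1 f z)^T.
apply: cvg_trans (cvg_trmx df).
by apply: near_eq_cvg; near=> h; rewrite linearZ linearB.
Unshelve. all: by end_near. Qed.

Lemma is_derive_chain (W : normedModType K) (g : K -> K) (f : K -> W) z :
  derivable g z 1 -> derivable f (g z) 1 ->
  is_derive z 1 (f \o g) ('D_1 g z *: 'D_1 f (g z)).
Proof.
move=> /derivable1_diffP dg /derivable1_diffP df.
have dfg := differentiable_comp dg df.
split; first exact/derivable1_diffP.
by rewrite !deriveE // diff_comp //= -[X in 'd f _ X]mulr1 linearZ.
Qed.

End MatrixDerivatives.

Section RealDerivative.
Variable R : realType.
Local Notation C := (cplx R).

Lemma cvg_ofR0 : (ofR t : C) @[t --> (0 : R)] --> (0 : C).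
Proof.
apply/cvgr0Pnorm_lt => e e0.
have eE : ofR (complex.Re e) = e by apply: RRe_real; exact: gtr0_real.
have Re0 : 0 < complex.Re e by rewrite -ltcR -[X in _ < X]/(ofR _) eE.
near=> t.
rewrite -eE /ofR normc_def /= expr0n addr0 sqrtr_sqr ltcR.
by near: t; exact: (@nbhs0_lt R R).
Unshelve. all: by end_near. Qed.

(** Approaching 0 along the real line through v is a special way of
    approaching 0 in the complex plane. *)
Lemma dRE (W : normedModType C) (F : C -> W) (z v : C) :
  derivable F z 1 -> dR F z v = v *: 'D_1 F z.
Proof.
move=> dF; apply: cvg_lim => //.
have [->|v0] := eqVneq v 0.
  rewrite scale0r (_ : dquot F z 0 = cst 0); first exact: cvg_cst.
  by apply/funext => t; rewrite /dquot mulr0 addr0 subrr scaler0.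
have tv0 : ofR t * v @[t --> (0 : R)^'] --> (0 : C)^'.
  have tv : ofR t * v @[t --> (0 : R)^'] --> (0 : C).
    rewrite -[X in _ --> X](mul0r v).
    by apply: cvgM; [exact: cvg_within_filter cvg_ofR0 | exact: cvg_cst].
  move=> P /tv nP.
  have {}nP : \forall t \near (0 : R)^', ofR t * v != 0 -> P (ofR t * v) := nP.
  apply: filterS2 nP (nbhs_dnbhs_neq (0 : R)) => t + t0; apply.
  by rewrite mulf_neq0 //; apply: contra_neq t0 => /complexI.
apply: cvg_trans (cvgZl_tmp (k := v) (cvg_comp _ _ tv0 dF)).
apply: near_eq_cvg; near=> t.
rewrite /= /dquot invfM scalerA mulrA mulrAC mulrV ?unitfE // mul1r.
by rewrite [_ *: 1]mulr1 [z + _]addrC.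
Unshelve. all: by end_near. Qed.

End RealDerivative.

(** * The Lorentz group *)

Section Lorentz.
Variables (F : comNzRingType) (m : nat).
Local Notation J := (Defs.minkowski F m).

Definition lorentz_inv (A : 'M[F]_m.+1) := J *m A^T *m J.

Lemma minkowski_sq : J *m J = 1%:M.
Proof.
rewrite mulmx_diag -diag_const_mx; congr diag_mx.
by apply/rowP => j; rewrite !mxE; case: ifP; rewrite ?mulrNN mulr1.
Qed.

Lemma minkowskiK p : cancel (@mulmx F _ _ p J) (mulmx J).
Proof. by move=> X; rewrite mulmxA minkowski_sq mul1mx. Qed.

Lemma tr_minkowski : J^T = J.
Proof. exact: tr_diag_mx. Qed.

Lemma lorentz_mulVmx A : lorentz_isometry A -> lorentz_inv A *m A = 1%:M.
Proof. by move=> LA; rewrite -!mulmxA (mulmxA A^T) LA minkowski_sq. Qed.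

Lemma lorentz_mulmxV A : lorentz_isometry A -> A *m lorentz_inv A = 1%:M.
Proof. by move/lorentz_mulVmx/mulmx1C. Qed.

Lemma lorentz_mulmx (A B : 'M[F]_m.+1) :
  lorentz_isometry A -> lorentz_isometry B -> lorentz_isometry (A *m B).
Proof.
move=> LA LB; rewrite /lorentz_isometry trmx_mul.
by rewrite -!mulmxA (mulmxA J) (mulmxA A^T) (mulmxA A^T) LA mulmxA.
Qed.

(** The defining relation A^T J A = J also yields A J A^T = J, because a left
    inverse of a square matrix is a right inverse. *)
Lemma lorentz_inv_isometry A :
  lorentz_isometry A -> lorentz_isometry (lorentz_inv A).
Proof.
move=> LA; have AJA : A *m J *m A^T = J.
  rewrite -[LHS]mulmx1 -minkowski_sq mulmxA -[A *m J *m A^T *m J]mulmxA.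
  have := lorentz_mulmxV LA; rewrite /lorentz_inv !mulmxA => ->.
  by rewrite mul1mx.
rewrite /lorentz_isometry /lorentz_inv !trmx_mul trmxK tr_minkowski.
rewrite -!mulmxA minkowskiK.
by rewrite (_ : A *m _ = J *m J) ?minkowskiK // !mulmxA AJA.
Qed.

Lemma det_lorentz_inv A : \det (lorentz_inv A) = \det A.
Proof.
rewrite !det_mulmx det_tr mulrAC -det_mulmx minkowski_sq det1.
by rewrite mul1r.
Qed.

End Lorentz.

Section Twist.
Variables (F : comNzRingType) (n : nat).
Local Notation J := (Defs.minkowski F (3 + n)).

(** Diagonal matrices commute, which makes J and Ptilde fixed points of
    sigma. *)
Lemma sgnmx_diag : sgnmx n F = diag_mx (row_mx (const_mx (-1)) (const_mx 1)).
Proof. by rewrite diag_mx_row !diag_const_mx raddfN. Qed.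

Lemma sgnmx_sq : sgnmx n F *m sgnmx n F = 1%:M.
Proof.
rewrite /sgnmx mulmx_block !mul0mx !mulmx0 mulmxN mulNmx opprK !mulmx1.
by rewrite !addr0 add0r -scalar_mx_block.
Qed.

Lemma sigmaM (X Y : 'M[F]_(4 + n)) : sigma (X *m Y) = sigma X *m sigma Y.
Proof.
rewrite /sigma -!mulmxA (mulmxA (sgnmx n F) (sgnmx n F)) sgnmx_sq mul1mx.
by [].
Qed.

Lemma sigma_diag (d : 'rV[F]_(4 + n)) : sigma (diag_mx d) = diag_mx d.
Proof.
rewrite /sigma sgnmx_diag diag_mxC -sgnmx_diag -mulmxA sgnmx_sq.
by rewrite mulmx1.
Qed.

Lemma sigma_block (A : 'M[F]_4) (B : 'M[F]_n) :
  sigma (block_mx A 0 0 B) = block_mx A 0 0 B.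
Proof.
rewrite /sigma /sgnmx !mulmx_block.
rewrite !(mul0mx, mulmx0, addr0, add0r, mulNmx, mulmxN, mul1mx, mulmx1).
by rewrite opprK oppr0.
Qed.

Lemma sigma_lorentz_inv (X : 'M[F]_(4 + n)) :
  sigma (@lorentz_inv F (3 + n) X) = @lorentz_inv F (3 + n) (sigma X).
Proof.
rewrite /lorentz_inv (sigmaM (J *m X^T) J) (sigmaM J) !sigma_diag.
congr (_ *m _ *m _); rewrite /sigma !trmx_mul !mulmxA.
by rewrite sgnmx_diag tr_diag_mx.
Qed.

Lemma minkowski_block :
  J = block_mx (Defs.minkowski F 3) 0 0 1%:M :> 'M[F]_(4 + n).
Proof.
rewrite -diag_const_mx -diag_mx_row; congr diag_mx.
apply/rowP => j; rewrite !mxE; case: splitP => k jk; rewrite !mxE //.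
  by rewrite -!val_eqE /= jk.
by rewrite -val_eqE /= jk.
Qed.

Lemma lorentz_block (A : 'M[F]_4) (B : 'M[F]_n) :
  @lorentz_isometry F 3 A -> B^T *m B = 1%:M ->
  @lorentz_isometry F (3 + n) (block_mx A 0 0 B).
Proof.
move=> LA OB; rewrite /lorentz_isometry minkowski_block.
have : (block_mx A 0 0 B)^T *m block_mx (Defs.minkowski F 3) 0 0 1%:M
    *m block_mx A 0 0 B
    = block_mx (Defs.minkowski F 3) 0 0 1%:M :> 'M[F]_(4 + n).
  rewrite tr_block_mx !trmx0 !mulmx_block !(mul0mx, mulmx0, addr0, add0r).
  by rewrite mulmx1 LA OB.
exact.
Qed.

Lemma Ptilde_sq : Ptilde n F *m Ptilde n F = 1%:M.
Proof.
rewrite mulmx_diag -diag_const_mx; congr diag_mx.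
by apply/rowP => j; rewrite !mxE; case: ifP; rewrite ?mulrNN mulr1.
Qed.

Lemma lorentz_Ptilde : @lorentz_isometry F (3 + n) (Ptilde n F).
Proof.
rewrite /lorentz_isometry tr_diag_mx /Ptilde /Defs.minkowski diag_mxC.
by rewrite -mulmxA Ptilde_sq mulmx1.
Qed.

Lemma det_Ptilde : (1 <= n)%N -> \det (Ptilde n F) = -1.
Proof.
move=> n1; rewrite det_diag.
have lt4 : (4 < 4 + n)%N by rewrite -addn1 leq_add2l.
rewrite (bigD1 (Ordinal lt4)) //= mxE /= big1 ?mulr1 // => j.
by rewrite -val_eqE mxE /= => /negbTE ->.
Qed.

End Twist.
(** * Twisted loops *)

Section Loops.
Variables (R : realType) (n : nat).
Local Notation C := (cplx R).
Local Notation linv := (@lorentz_inv C (3 + n)).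
Implicit Types (f g : C -> 'M[C]_(4 + n)) (A B P Q : 'M[C]_(4 + n)).

Lemma within_continuous_mulmx (E : set C) f g :
  {within E, continuous f} -> {within E, continuous g} ->
  {within E, continuous (fun l => f l *m g l)}.
Proof. by move=> cf cg l; apply: cvg_mulmx; [exact: cf | exact: cg]. Qed.

Lemma within_continuous_lorentz_inv (E : set C) g :
  {within E, continuous g} -> {within E, continuous (fun l => linv (g l))}.
Proof.
move=> cg l; apply: cvg_mulmx (cvg_cst _).
by apply: cvg_mulmx; [exact: cvg_cst | apply: cvg_trmx; exact: cg].
Qed.

Lemma derivable_mulmx f g z : derivable f z 1 -> derivable g z 1 ->
  derivable (fun w => f w *m g w) z 1.
Proof. by move=> df dg; have [] := is_derive_mulmx df dg. Qed.

Lemma derivable_lorentz_inv g z :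
  derivable g z 1 -> derivable (fun w => linv (g w)) z 1.
Proof.
move=> dg; apply: derivable_mulmx (derivable_cst _ _ _).
by apply: derivable_mulmx; [exact: derivable_cst | exact: derivable_trmx].
Qed.

Lemma SOC_sandwich A P B Q : SOC A -> SOC B ->
  @lorentz_isometry C (3 + n) P -> @lorentz_isometry C (3 + n) Q ->
  \det P * \det Q = 1 -> SOC (A *m P *m B *m Q).
Proof.
move=> [LA dA] [LB dB] LP LQ dPQ; split.
  by do 3?apply: lorentz_mulmx.
by rewrite !det_mulmx dA dB mulr1 mul1r.
Qed.

Lemma SOC_lorentz_inv A : SOC A -> SOC (linv A).
Proof.
move=> [LA dA]; split; first exact: lorentz_inv_isometry.
by rewrite [LHS]det_lorentz_inv.
Qed.

(** Only the product of the determinants of P and Q is prescribed, so that one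
    statement covers both P = k(z), Q = 1 with det k(z) = 1 and P = k(z),
    Q = Ptilde with det k(z) = -1. *)
Lemma LoopPlus_sandwich f g P Q : LoopPlus f -> LoopPlus g ->
  @lorentz_isometry C (3 + n) P -> @lorentz_isometry C (3 + n) Q ->
  sigma P = P -> sigma Q = Q -> \det P * \det Q = 1 ->
  LoopPlus (fun l => f l *m P *m g l *m Q).
Proof.
move=> [[cf Sf] [hf [chf dhf Shf hfE]]] [[cg Sg] [hg [chg dhg Shg hgE]]].
move=> LP LQ sP sQ dPQ.
have cM (E : set C) f' g' : {within E, continuous f'} ->
    {within E, continuous g'} ->
    {within E, continuous (fun l => f' l *m P *m g' l *m Q)}.
  move=> cf' cg'.
  have cc A : {within E, continuous (fun=> A : 'M[C]_(4 + n))}.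
    by move=> l; exact: cvg_cst.
  exact: (within_continuous_mulmx (within_continuous_mulmx
    (within_continuous_mulmx cf' (cc P)) cg') (cc Q)).
split.
  split; first exact: (cM _ f g cf cg).
  move=> l Cl; have [[Sfl sfl] [Sgl sgl]] := (Sf l Cl, Sg l Cl).
  split; first exact: SOC_sandwich.
  by rewrite !sigmaM sfl sgl sP sQ.
exists (fun l => hf l *m P *m hg l *m Q); split.
- exact: (cM _ hf hg chf chg).
- move=> l l1; apply: derivable_mulmx (derivable_cst _ _ _).
  apply: derivable_mulmx; last exact: dhg.
  by apply: derivable_mulmx; [exact: dhf | exact: derivable_cst].
- by move=> l l1; apply: SOC_sandwich => //; [exact: Shf | exact: Shg].
- by move=> l Cl; rewrite hfE ?hgE.
Qed.

Lemma LoopPlus_inv g : LoopPlus g -> LoopPlus (fun l => linv (g l)).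
Proof.
move=> [[cg Sg] [h [ch dh Sh hE]]]; split.
  split; first exact: (within_continuous_lorentz_inv cg).
  move=> l Cl; have [Sgl sgl] := Sg l Cl.
  by split; [exact: SOC_lorentz_inv | rewrite sigma_lorentz_inv sgl].
exists (fun l => linv (h l)); split.
- exact: (within_continuous_lorentz_inv ch).
- by move=> l l1; apply: derivable_lorentz_inv; exact: dh.
- by move=> l l1; apply: SOC_lorentz_inv; exact: Sh.
- by move=> l Cl; rewrite hE.
Qed.

Lemma eq_LoopPlus f g :
  (forall l, circle l -> f l = g l) -> LoopPlus f -> LoopPlus g.
Proof.
move=> fg [[cf Sf] [h [ch dh Sh hE]]]; split.
  split; first by apply: subspace_eq_continuous cf => l /set_mem /fg.
  move=> l Cl; have CNl : circle (- l) by rewrite /circle /= normrN.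
  by rewrite -!fg //; exact: Sf.
by exists h; split=> // l Cl; rewrite hE // fg.
Qed.

End Loops.

HB.instance Definition _ (R : realType) :=
  GRing.RMorphism.copy (@ofR R : R -> cplx R) (real_complex R).

(** Block diagonal matrices are the ones fixed by sigma, so k(z) is a constant
    twisted loop, up to its determinant. *)
Lemma cmx_KO (R : realType) n (k : 'M[R]_(4 + n)) : KO k ->
  @lorentz_isometry (cplx R) (3 + n) (cmx k) /\ sigma (cmx k) = cmx k.
Proof.
move=> [A SA [B OB <-]].
have LA : @lorentz_isometry R 3 A by have [] := connected_component_sub SA.
have cmxE : cmx (block_mx A 0 0 B) = block_mx (cmx A) 0 0 (cmx B).
  by rewrite /cmx map_block_mx !map_mx0.
rewrite [cmx _]cmxE; split; last exact: sigma_block.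
apply: lorentz_block.
  have mE : Defs.minkowski (cplx R) 3 = cmx (Defs.minkowski R 3).
    apply/matrixP => i j; rewrite !mxE rmorphMn; congr (_ *+ _).
    by case: ifP; rewrite ?rmorphN rmorph1.
  rewrite /lorentz_isometry mE /cmx map_trmx -!map_mxM.
  by rewrite LA.
by rewrite /cmx map_trmx -map_mxM OB map_mx1.
Qed.

(** The absence of accumulation points is what makes D minus S open, so that
    identities valid there can be differentiated. *)
Lemma open_setD_discrete (R : realType) (D S : set (cplx R)) z :
  open D -> discrete_in D S -> (D `\` S) z -> \forall w \near z, (D `\` S) w.
Proof.
move=> oD [_ DS0] [Dz nSz].
have nlim : ~ limit_point S z.
  by move=> lz; have : (D `&` limit_point S) z by []; rewrite DS0.
have [U [Uz noS]] : exists U, nbhs z U /\ forall y, y != z -> S y -> ~ U y.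
  apply: contrapT => noU; apply: nlim => U Uz; apply: contrapT => noy.
  apply: noU; exists U; split=> // y yz Sy Uy; apply: noy.
  by exists y.
have nD : \forall w \near z, D w by exact: open_nbhs_nbhs.
apply: filterS2 nD Uz => w Dw Uw; split=> // Sw.
have [wz|wz] := eqVneq w z; first by apply: nSz; rewrite -wz.
exact: noS Uw.
Qed.
(** * Gauge transformations and the normalized potential *)

Section Gauge.
Variables (R : realType) (n : nat).
Local Notation C := (cplx R).
Local Notation M := 'M[C]_(4 + n).

Lemma pullback_maurer_cartan (g : C -> C) (F : C -> M) z v :
  derivable g z 1 -> derivable F (g z) 1 ->
  pullback g (maurer_cartan F) z v = maurer_cartan (F \o g) z v.
Proof.
move=> dg dF; have [dFg DFg] := is_derive_chain dg dF.
rewrite /pullback /maurer_cartan (dRE v dg) (dRE _ dF) (dRE v dFg).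
by rewrite DFg scalerA.
Qed.

(** The constant chi disappears because it cancels in G^-1 dG. *)
Lemma maurer_cartan_gauge (chi : M) (F G V : C -> M) z v :
  chi \in unitmx -> F z \in unitmx -> V z \in unitmx ->
  derivable F z 1 -> derivable V z 1 ->
  (\forall w \near z, G w = chi *m F w *m V w) ->
  maurer_cartan G z v =
    invmx (V z) *m maurer_cartan F z v *m V z + invmx (V z) *m dR V z v.
Proof.
move=> Uchi UF UV dF dV GE.
have dcF := is_derive_mulmx (derivable_cst chi z 1) dF.
have dcFV := is_derive_mulmx (ex_derive (is_derive := dcF)) dV.
have EG : \forall w \near z, chi *m F w *m V w = G w.
  by apply: filterS GE => w ->.
have [dG DG] := near_eq_is_derive EG dcFV.
have GzE := nbhs_singleton GE.
rewrite /maurer_cartan (dRE v dF) (dRE v dV) (dRE v dG) DG.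
rewrite (derive_val (is_derive := dcF)).
rewrite derive_cst mul0mx add0r GzE.
have -> : invmx (chi *m F z *m V z) = invmx (V z) *m invmx (F z) *m invmx chi.
  have UG : chi *m F z *m V z \in unitmx by rewrite !unitmx_mul Uchi UF UV.
  apply: (can_inj (mulKmx UG)); rewrite mulmxV // !mulmxA mulmxK // mulmxK //.
  by rewrite mulmxV.
rewrite -!scalemxAr -!scalemxAl -scalerDr; congr (_ *: _).
by rewrite mulmxDr -!mulmxA !(mulKmx Uchi) (mulKmx UF).
Qed.

End Gauge.

(** X Xp and Y Yp stand for the Birkhoff decompositions of the frame at z and
    at gamma(z). Taking determinants makes chi invertible. The matrix
    X^-1 chi^-1 Y is then both the quotient of the minus factors and, after
    cancelling chi and X, an expression in the plus factors. *)
Lemma monodromy_gauge (R : realType) (n : nat)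
    (X Xp Y Yp chi k : 'M[cplx R]_(4 + n)) :
  SOC X -> SOC Xp -> SOC Y -> SOC Yp ->
  Y *m Yp = chi *m (X *m Xp) *m k ->
  [/\ \det chi * \det k = 1, chi \in unitmx,
      Y = chi *m X *m (@lorentz_inv _ (3 + n) X *m invmx chi *m Y) &
      @lorentz_inv _ (3 + n) X *m invmx chi *m Y
        = Xp *m k *m @lorentz_inv _ (3 + n) Yp].
Proof.
move=> [LX dX] [LXp dXp] [LY dY] [LYp dYp] E.
have detE : \det chi * \det k = 1.
  by have := congr1 determinant E; rewrite !det_mulmx dX dXp dY dYp !mulr1.
have Uchi : chi \in unitmx.
  rewrite unitmxE unitfE; apply: contra_eq_neq detE => ->.
  by rewrite mul0r eq_sym oner_eq0.
move: (lorentz_mulmxV LX) (lorentz_mulVmx LX) (lorentz_mulmxV LYp).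
move: (lorentz_inv X) (lorentz_inv Yp) => Xi Ypi XXi XiX YpYpi.
split=> //; first by rewrite !mulmxA -(mulmxA chi) XXi mulmx1 mulmxV // mul1mx.
have -> : Y = chi *m (X *m Xp) *m k *m Ypi by rewrite -E -mulmxA YpYpi mulmx1.
by rewrite -!mulmxA (mulKmx Uchi) !mulmxA XiX mul1mx.
Qed.

Theorem theorem4p5 (R : realType) (n : nat)
    (D : set (cplx R)) (f : cplx R -> set 'M[R]_(4 + n))
    (gamma : cplx R -> cplx R) (A : 'M[R]_(4 + n))
    (F0 : cplx R -> 'M[R]_(4 + n))
    (F : cplx R -> cplx R -> 'M[cplx R]_(4 + n))
    (S : set (cplx R))
    (Fm Fp : cplx R -> cplx R -> 'M[cplx R]_(4 + n))
    (chi : cplx R -> 'M[cplx R]_(4 + n)) :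
  (1 <= n)%N ->
  open D -> contractible D -> D 0 ->
  harmonic_map D f -> f 0 = cosetK 1%:M ->
  is_symmetry D f gamma A ->
  is_lift D f F0 -> extended_frame D F0 F ->
  birkhoff D F S Fm Fp ->
  monodromy D F gamma A chi ->
  let D' := [set z | D z /\ ~ S z /\ ~ S (gamma z)] in
  let eta := normalized_potential Fm in
  exists V : cplx R -> cplx R -> 'M[cplx R]_(4 + n),
    [/\ forall z l, D' z -> circle l -> Fm (gamma z) l = chi l *m Fm z l *m V z l,
        (forall l, circle l -> \det (chi l) = 1) ->
          forall z, D' z -> LoopPlus (V z),
        (forall l, circle l -> \det (chi l) = -1) ->
          forall z, D' z -> LoopPlus (fun l => V z l *m Ptilde n (cplx R)),
        forall l, circle l -> holomorphic_on D' (V^~ l) &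
        forall l z v, circle l -> D' z ->
          pullback gamma (eta l) z v =
            invmx (V z l) *m eta l z v *m V z l
            + invmx (V z l) *m dR (V^~ l) z v].
Proof.
move=> n1 oD _ _ _ _ [[h [dgamma _ gammaD _]] _ _] _ _.
move=> [discS loops FE merom] [[k [KOk monE]] _ _] D' eta.
pose linv := @lorentz_inv (cplx R) (3 + n).
pose V z l := linv (Fm z l) *m invmx (chi l) *m Fm (gamma z) l.
have D'P z : D' z -> (D `\` S) z /\ (D `\` S) (gamma z).
  by move=> [Dz [nSz nSgz]]; do 2?split=> //; have [] := gammaD z Dz.
have SOC_loops z l : (D `\` S) z -> circle l -> SOC (Fm z l) /\ SOC (Fp z l).
  move=> /loops [[[_ Sm] _] [[_ Sp] _]] Cl.
  by have [[? _] [? _]] := (Sm l Cl, Sp l Cl).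
have gauge z l : D' z -> circle l ->
    [/\ \det (chi l) * \det (cmx (k z)) = 1, chi l \in unitmx,
        Fm (gamma z) l = chi l *m Fm z l *m V z l &
        V z l = Fp z l *m cmx (k z) *m linv (Fp (gamma z) l)].
  move=> D'z Cl; have [DSz DSgz] := D'P z D'z.
  have [SX SXp] := SOC_loops z l DSz Cl.
  have [SY SYp] := SOC_loops (gamma z) l DSgz Cl.
  by apply: monodromy_gauge => //; rewrite -!FE // monE //; case: DSz.
(* k(z) is independent of lambda, so det k(z) may be computed at lambda = 1. *)
have C1 : @circle R 1 by rewrite /circle /= normr1.
have LoopPlusV z Q : D' z -> @lorentz_isometry _ (3 + n) Q -> sigma Q = Q ->
    (forall l, circle l -> \det (chi l) = \det Q) ->
    LoopPlus (fun l => V z l *m Q).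
  move=> D'z LQ sQ detE; have [DSz DSgz] := D'P z D'z.
  have [Lk sk] := cmx_KO (KOk z (proj1 DSz)).
  have detk : \det (cmx (k z)) * \det Q = 1.
    by rewrite mulrC -(detE 1 C1); have [] := gauge z 1 D'z C1.
  have [[_ LFp] [_ LFpg]] := (loops z DSz, loops (gamma z) DSgz).
  apply: eq_LoopPlus
    (LoopPlus_sandwich LFp (LoopPlus_inv LFpg) Lk LQ sk sQ detk).
  by move=> l Cl; have [_ _ _ ->] := gauge z l D'z Cl.
have dFm l z : circle l -> (D `\` S) z -> derivable (Fm^~ l) z 1.
  by move=> Cl; have [+ _] := merom l Cl; apply.
have dFmg l z : circle l -> D' z -> derivable (fun w => Fm (gamma w) l) z 1.
  move=> Cl D'z; have [DSz DSgz] := D'P z D'z.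
  exact: (ex_derive (is_derive :=
    is_derive_chain (dgamma z (proj1 DSz)) (dFm l (gamma z) Cl DSgz))).
have dV l z : circle l -> D' z -> derivable (V^~ l) z 1.
  move=> Cl D'z; have [DSz DSgz] := D'P z D'z.
  apply: derivable_mulmx; last exact: dFmg.
  apply: derivable_mulmx; last exact: derivable_cst.
  exact: derivable_lorentz_inv (dFm l z Cl DSz).
exists V; split.
- by move=> z l D'z Cl; have [] := gauge z l D'z Cl.
- move=> detchi1 z D'z.
  have := LoopPlusV z 1%:M D'z; under eq_fun do rewrite mulmx1.
  apply.
  + by rewrite /lorentz_isometry trmx1 mul1mx mulmx1.
  + by rewrite /sigma mulmx1 sgnmx_sq.
  + by move=> l /detchi1; rewrite det1.
- move=> detN1 z D'z; apply: (LoopPlusV z _ D'z (lorentz_Ptilde _ _)).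
  + exact: sigma_diag.
  + by move=> l /detN1; rewrite det_Ptilde.
- by move=> l Cl z; exact: dV.
move=> l z v Cl D'z; have [DSz DSgz] := D'P z D'z.
rewrite /eta /normalized_potential pullback_maurer_cartan //; first last.
- exact: dFm.
- by apply: dgamma; case: DSz.
have [detk Uchi GE VE] := gauge z l D'z Cl.
have D'near : \forall w \near z, D' w.
  have cg := derivable1_continuous (dgamma z (proj1 DSz)).
  apply: filterS2 (open_setD_discrete oD discS DSz)
    (cg _ (open_setD_discrete oD discS DSgz)) => w.
  by move=> [Dw nSw] [_ nSgw].
have [[LFm detFm] _] := SOC_loops z l DSz Cl.
have [[_ detFmg] _] := SOC_loops (gamma z) l DSgz Cl.
apply: (maurer_cartan_gauge (chi := chi l)) => //.
- by rewrite unitmxE detFm unitr1.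
- have [Uinv _] := mulmx1_unit (lorentz_mulVmx LFm).
  have Ug : Fm (gamma z) l \in unitmx by rewrite unitmxE detFmg unitr1.
  by rewrite /V unitmx_mul Ug andbT unitmx_mul unitmx_inv Uchi andbT.
- exact: dFm.
- exact: dV.
- by apply: filterS D'near => w D'w; have [] := gauge w l D'w Cl.
Qed.
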